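(* Let $\mathbf{R}$ be a finite commutative ring with unity. Then $\mathbf{R}$ is (up to isomorphism) a product $R_1\times R_2\times\cdots\times R_n$ where each $R_i$ is a finite local ring, and hence $$\omega(\mathbf{R})=\prod_{i=1}^{n}\bigl(\omega(R_i)-|\mathcal{C}_i|\bigr)+\sum_{i=1}^{n}\bigl(\omega(R_i)-|\mathcal{B}_i|\bigr),$$ where for each $i$, $\mathcal{A}_i$ is a maximum clique of $R_i$ chosen so that the number of its elements with square zero is as large as possible among all maximum cliques of $R_i$, $\mathcal{B}_i=\{x\in\mathcal{A}_i : x^2=0\}$ and $\mathcal{C}_i=\{x\in\mathcal{A}_i : x^2\neq 0\}$.
   Context: All rings are commutative with unity. A ring $R$ is regarded as a simple graph whose vertices are all elements of $R$ (including $0$), two distinct vertices $x,y$ being adjacent if and only if $xy=0$. A clique of $R$ is a subset $A\subseteq R$ that induces a complete subgraph, i.e. $xy=0$ for all distinct $x,y\in A$. The clique number $\omega(R)$ is the maximum size of a clique of $R$, and a maximum clique is a clique $A$ with $|A|=\omega(R)$. A ring is local if it has a unique maximal ideal. *)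

(* Defs.v *)
From HB Require Import structures.
From mathcomp Require Import all_boot all_order all_algebra.
Set Implicit Arguments.
Unset Strict Implicit.
Unset Printing Implicit Defensive.
Import GRing.Theory.
Local Open Scope ring_scope.

Definition adjacent (R : finComPzRingType) : rel R :=
  [rel x y | (x != y) && (x * y == 0)].

Definition clique (R : finComPzRingType) (A : {set R}) : bool :=
  [forall x in A, forall y in A, (x != y) ==> adjacent x y].

Definition omega (R : finComPzRingType) : nat :=
  (\max_(A : {set R} | clique A) #|A|)%N.

Definition maximum_clique (R : finComPzRingType) (A : {set R}) : bool :=
  clique A && (#|A| == omega R).

Definition square_zero_part (R : finComPzRingType) (A : {set R}) : {set R} :=
  [set x in A | x ^+ 2 == 0].

Definition square_nonzero_part (R : finComPzRingType) (A : {set R}) : {set R} :=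
  [set x in A | x ^+ 2 != 0].

Definition optimal_maximum_clique (R : finComPzRingType) (A : {set R}) : Prop :=
  maximum_clique A /\
  forall A' : {set R}, maximum_clique A' ->
    (#|square_zero_part A'| <= #|square_zero_part A|)%N.

(* [idealr_closed] already requires [1 \notin M], i.e. that M be proper. *)
Definition maximal_ideal (R : finComNzRingType) (M : {set R}) : Prop :=
  idealr_closed M /\
  forall J : {set R}, idealr_closed J -> M \subset J -> J = M.

Definition local_ring (R : finComNzRingType) : Prop :=
  exists! M : {set R}, maximal_ideal M.

(* The direct product of a finite family of rings, with componentwise
   operations; an alias is used because the library already puts a
   multiplicative group structure on some types {dffun _}. *)
Definition prod_ring (n : nat) (R_ : 'I_n -> finComNzRingType) : Type :=
  {dffun forall i : 'I_n, R_ i}.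

Section ProdRing.
Variables (n : nat) (R_ : 'I_n -> finComNzRingType).
Local Notation P := (prod_ring R_).
Implicit Types x y z : P.

HB.instance Definition _ := Finite.copy P {dffun forall i : 'I_n, R_ i}.

Definition prod_zero : P := [ffun i => 0 : R_ i].
Definition prod_one : P := [ffun i => 1 : R_ i].
Definition prod_opp x : P := [ffun i => - x i].
Definition prod_add x y : P := [ffun i => x i + y i].
Definition prod_mul x y : P := [ffun i => x i * y i].

Fact prod_addA : associative prod_add.
Proof. by move=> x y z; apply/ffunP=> i; rewrite !ffunE addrA. Qed.
Fact prod_addC : commutative prod_add.
Proof. by move=> x y; apply/ffunP=> i; rewrite !ffunE addrC. Qed.
Fact prod_add0 : left_id prod_zero prod_add.
Proof. by move=> x; apply/ffunP=> i; rewrite !ffunE add0r. Qed.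
Fact prod_addN : left_inverse prod_zero prod_opp prod_add.
Proof. by move=> x; apply/ffunP=> i; rewrite !ffunE addNr. Qed.

HB.instance Definition _ :=
  GRing.isZmodule.Build P prod_addA prod_addC prod_add0 prod_addN.

Fact prod_mulA : associative prod_mul.
Proof. by move=> x y z; apply/ffunP=> i; rewrite !ffunE mulrA. Qed.
Fact prod_mulC : commutative prod_mul.
Proof. by move=> x y; apply/ffunP=> i; rewrite !ffunE mulrC. Qed.
Fact prod_mul1 : left_id prod_one prod_mul.
Proof. by move=> x; apply/ffunP=> i; rewrite !ffunE mul1r. Qed.
Fact prod_mulD : left_distributive prod_mul +%R.
Proof. by move=> x y z; apply/ffunP=> i; rewrite !ffunE mulrDl. Qed.

HB.instance Definition _ :=
  GRing.Zmodule_isComPzRing.Build P prod_mulA prod_mulC prod_mul1 prod_mulD.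

End ProdRing.

Definition ring_isomorphic (R S : pzRingType) : Prop :=
  exists f : {rmorphism R -> S}, bijective f.

(* Main.v *)
Require Import Defs.
From HB Require Import structures.
From mathcomp Require Import all_boot all_order all_algebra.
From mathcomp Require Import fingroup cyclic pgroup abelian zify.

Set Implicit Arguments.
Unset Strict Implicit.
Unset Printing Implicit Defensive.
Import GRing.Theory.
Local Open Scope ring_scope.

(** A finite commutative ring is the product of its corner rings [e R], one for
    each primitive idempotent [e]: distinct primitive idempotents are orthogonal
    and they add up to [1].  A corner at a primitive idempotent has no
    idempotents besides [0] and [1], and in a finite ring some positive power of
    every element is idempotent, so each element of the corner is nilpotent or
    invertible and the nilpotent ones form the only maximal ideal.

    For the formula put [b_i = #|B_i|] and [c_i = #|C_i|].  Since
    [omega (R_i) = b_i + c_i], it says that [omega R = \prod b_i + \sum c_i].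

    The product of the [B_i], together with the elements that have one
    coordinate in some [C_i] and all others [0], is a clique; hence [>=].

    Conversely let [S] be a clique of the product.  Its elements of square zero
    project to sets [D_i] in which all products vanish, squares included.  Let
    [E_i] be the set of those [i]-th coordinates of elements of [S] whose square
    is nonzero; an element of nonzero square contributes to some [E_i], and two
    different ones never contribute the same element to it.  Then
    [#|S| <= \prod #|D_i| + \sum #|E_i|], and [D_i :|: E_i] is a clique, so
    [#|D_i| + #|E_i| <= b_i + c_i].  To conclude one must exclude that a large
    [D_i] makes the product exceed [\prod b_i], which is the heart of the
    matter ([card_zero_product]): in a local ring, an optimal maximum clique has
    at least as many elements of square zero as any set [D] whose products all
    vanish.

    This rests on an exchange ([exchange]).  If all products in [D] vanish, they
    still do in the double annihilator [K] of [D]; the union of [K] with the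
    elements of [C] that kill [D] is a clique, so optimality bounds [#|K|] in
    terms of [#|B|] and the number of elements of [C] that do not kill [D].  In
    a local ring of residue characteristic [p] the orders of [K] and [B] are
    powers of [p], and the exchange yields [#|K| <= #|B|] as soon as at most
    [(p - 1) * #|B|] elements of [C] fail to kill [D].  So it is enough to show
    [#|C| <= (p - 1) * #|B|] ([card_square_nonzero_part]).  When [C] has at
    least two elements, its squares are killed by all nilpotents and lie in [B],
    and fewer than [p] elements [c] of [C] share a square [t]: the sum [x] of
    [p] of them would satisfy [x ^+ 2 = p t = 0] and kill all of [B] and the
    rest of [C], so the exchange would place [x] in [B], against
    [x * c = t != 0]. *)

(** * Preliminaries on finite additive groups *)

(** This makes the orders of double annihilators in a local ring comparable:
    an order below [p ^ b.+1] is at most [p ^ b]. *)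
Lemma card_ptorsion_subgroup (V : finZmodType) (K : {set V}) (p N : nat) :
    prime p -> 0 \in K -> {in K &, forall x y, x + y \in K} ->
    {in K, forall x, x *+ p ^ N = 0} ->
  exists a, #|K| = (p ^ a)%N.
Proof.
move=> p_prime K0 KD torsK.
have gK : group_set K.
  by apply/group_setP; split=> // x y Kx Ky; apply: KD.
have : (p.-group (Group gK))%g.
  rewrite -pnat_exponent; apply: (@pnat_dvd _ (p ^ N)%N); last first.
    by rewrite pnatX pnat_id.
  by apply/exponentP=> x Kx; rewrite FinRing.zmodXgE; apply: torsK.
by case/p_natP=> a oK; exists a.
Qed.

Lemma mulrn_card_eq0 (V : finZmodType) (x : V) : x *+ #|V| = 0.
Proof.
rewrite -FinRing.zmodXgE -cardsT.
by have := expg_cardG (in_setT (x : FinRing.Zmodule_to_finGroup V)).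
Qed.

(** * Idempotents and local rings *)

(** The powers of [x] are eventually periodic: [x ^+ (m + d) = x ^+ m] for
    [m > i] and some [d > 0].  An exponent beyond [i] that is a multiple of [d]
    is idempotent. *)
Lemma exists_idempotent_power (R : finComPzRingType) (x : R) :
  exists k, (0 < k)%N /\ x ^+ k * x ^+ k = x ^+ k.
Proof.
pose f (i : 'I_(#|R|.+1)) := x ^+ i.+1.
have /injectivePn[i [j neq_ij eq_f]] : ~~ injectiveb f.
  by apply/negP=> /injectiveP/leq_card; rewrite card_ord ltnn.
wlog lt_ij : i j neq_ij eq_f / (i < j)%N.
  move=> IH; case: (ltngtP i j) => [|ltji|/val_inj eq_ij]; first exact: IH.
    by apply: (IH j i); rewrite // eq_sym.
  by rewrite eq_ij eqxx in neq_ij.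
pose d := (j - i)%N.
have period m : (i < m)%N -> x ^+ (m + d) = x ^+ m.
  move=> lt_im; have -> : (m + d = j.+1 + (m - i.+1))%N by rewrite /d; lia.
  by rewrite exprD -[x ^+ j.+1]eq_f -exprD subnKC.
have multiple m q : (i < m)%N -> x ^+ (m + q * d) = x ^+ m.
  move=> lt_im; elim: q => [|q IH]; first by rewrite addn0.
  by rewrite mulSn addnCA addnC period ?IH //; lia.
exists (i.+1 * d)%N; rewrite -exprD multiple; last first.
  by rewrite -[X in (X < _)%N]muln1 -ltnS; rewrite /d; nia.
by split=> //; rewrite muln_gt0 /= /d subn_gt0.
Qed.

Definition only_trivial_idempotents (R : pzRingType) :=
  forall e : R, e * e = e -> e = 0 \/ e = 1.

Definition nilpotent (R : pzRingType) (x : R) := exists k, x ^+ k = 0.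

Lemma nilpotent_or_invertible (R : finComNzRingType) (x : R) :
    only_trivial_idempotents R ->
  nilpotent x \/ exists y, x * y = 1.
Proof.
move=> trivR; have [k [k_gt0 idem]] := exists_idempotent_power x.
case: (trivR _ idem) => [x0|x1]; [by left; exists k | right].
by exists (x ^+ k.-1); rewrite -exprS prednK.
Qed.

Lemma nilpotent_non_invertible (R : comNzRingType) (x y : R) :
  nilpotent x -> x * y != 1.
Proof.
case=> k xk0; apply/eqP=> xy1; have := expr1n R k.
by rewrite -xy1 exprMn xk0 mul0r => /esym/eqP; rewrite xy1 oner_eq0.
Qed.

Lemma sub_maximal_ideal (R : finComNzRingType) (J : {set R}) :
  idealr_closed J -> exists2 M : {set R}, maximal_ideal M & J \subset M.
Proof.
move=> idJ.
pose idealb (I : {set R}) := [&& 0 \in I, 1 \notin I &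
  [forall a, forall u in I, forall v in I, a * u + v \in I]].
have idealP (I : {set R}) : reflect (idealr_closed I) (idealb I).
  apply: (iffP and3P) => [[I0 I1 Ilin]|[I0 I1 Ilin]]; split=> //.
    move=> a u v Iu Iv.
    by move/forallP/(_ a)/forall_inP/(_ u Iu)/forall_inP/(_ v Iv): Ilin.
  apply/forallP=> a; apply/forall_inP=> u Iu; apply/forall_inP=> v.
  exact: Ilin.
have [M /maxsetP[/idealP idM maxM] sJM] :=
  @maxset_exists _ idealb J (introT (idealP J) idJ).
by exists M => //; split=> // I /idealP idI sMI; apply: maxM.
Qed.

(** If [e] and [1 - e] were both nonzero, both would lie in the maximal ideal,
    and so would their sum [1]. *)
Lemma local_ring_trivial_idempotents (R : finComNzRingType) :
  local_ring R -> only_trivial_idempotents R.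
Proof.
case=> M [[[M0 M1 Mlin] _] Muniq] e idem_e.
(* A non-trivial idempotent is a zero divisor, so the ideal it generates is
   proper. *)
have inM f g : f * f = f -> g != 0 -> g * f = 0 -> f \in M.
  move=> idem_f nz_g gf0; pose J := [set f * x | x : R].
  have idJ : idealr_closed J.
    split; first by apply/imsetP; exists 0; rewrite ?mulr0.
      apply/imsetP=> -[x _ x1]; case/eqP: nz_g.
      by rewrite -[g]mulr1 x1 mulrA gf0 mul0r.
    move=> a _ _ /imsetP[u _ ->] /imsetP[v _ ->]; apply/imsetP.
    by exists (a * u + v); rewrite // mulrDr mulrCA.
  have [M' maxM' /subsetP sJM'] := sub_maximal_ideal idJ.
  by rewrite (Muniq _ maxM') sJM' //; apply/imsetP; exists 1; rewrite ?mulr1.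
have [->|nz_e] := eqVneq e 0; first by left.
have [e1|nz_e'] := eqVneq (1 - e) 0; first by right; apply/esym/subr0_eq.
have ee'0 : e * (1 - e) = 0 by rewrite mulrBr mulr1 idem_e subrr.
have idem_e' : (1 - e) * (1 - e) = 1 - e by rewrite mulrBl ee'0 subr0 mul1r.
case/negP: M1; rewrite -(subrK e 1) -[1 - e]mul1r; apply: Mlin.
  exact: inM ee'0.
by apply: (inM _ (1 - e)); rewrite // mulrC.
Qed.

(** The nilpotent elements form an ideal containing every proper ideal, since
    the elements of a proper ideal are not invertible. *)
Lemma trivial_idempotents_local_ring (R : finComNzRingType) :
  only_trivial_idempotents R -> local_ring R.
Proof.
move=> trivR.
pose M := [set x : R | [forall y, x * y != 1]].
have MP x : reflect (nilpotent x) (x \in M).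
  rewrite inE; apply: (iffP forallP) => [nox|nx y]; last first.
    exact: nilpotent_non_invertible.
  case: (nilpotent_or_invertible x trivR) => // -[y xy1].
  by have := nox y; rewrite xy1 eqxx.
have idM : idealr_closed M.
  split.
  - by apply/MP; exists 1; rewrite expr1.
  - by apply/MP=> -[k /eqP]; rewrite expr1n oner_eq0.
  move=> a u v /MP[k uk0] /MP[l vl0]; apply/MP; exists (k + l)%N.
  rewrite exprDn big1 // => i _; case: (leqP l i) => [le_li|lt_il].
    by rewrite -(subnK le_li) exprD vl0 !mulr0 mul0rn.
  have -> : (k + l - i = (l - i) + k)%N by lia.
  by rewrite exprMn (exprD u) uk0 !(mulr0, mul0r) mul0rn.
have sM J : idealr_closed J -> J \subset M.
  case=> J0 J1 Jlin; apply/subsetP=> x Jx; rewrite inE; apply/forallP=> y.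
  apply: contraNneq J1 => <-; rewrite mulrC -[y * x]addr0.
  exact: Jlin.
exists M; split=> [|M' [idM' maxM']]; last exact/maxM'/sM.
by split=> // J /sM sJM sMJ; apply/eqP; rewrite eqEsubset sJM.
Qed.

(** The least [k > 0] that is not invertible in [R] exceeds [1]; if [p] is a
    prime factor of [k], then [k / p] is invertible by minimality, so [p] is
    not, and is therefore nilpotent. *)
Lemma residue_characteristic (R : finComNzRingType) :
  only_trivial_idempotents R -> exists2 p, prime p & nilpotent (p%:R : R).
Proof.
move=> trivR; pose P k := (0 < k)%N && [forall y : R, k%:R * y != 1].
have exP : exists k, P k.
  exists #|R|; apply/andP; split; first by apply/card_gt0P; exists 0.
  by apply/forallP=> y; rewrite mulrn_card_eq0 mul0r eq_sym oner_eq0.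
have [k /andP[k_gt0 /forallP nonunit_k] min_k] := ex_minnP exP.
have k_gt1 : (1 < k)%N.
  rewrite ltn_neqAle k_gt0 andbT; apply/eqP=> k1.
  by have := nonunit_k 1; rewrite -k1 mulr1 eqxx.
exists (pdiv k); first exact: pdiv_prime.
have [//|[y py1]] := nilpotent_or_invertible (pdiv k)%:R trivR.
have : ~~ P (k %/ pdiv k)%N.
  apply/negP=> /min_k; rewrite leqNgt ltn_Pdiv //.
  exact/prime_gt1/pdiv_prime.
rewrite /P divn_gt0 ?pdiv_gt0 // pdiv_leq //= => /forallPn[z]; rewrite negbK.
move=> /eqP kz1; case/eqP: (nonunit_k (z * y)).
by rewrite -(divnK (pdiv_dvd k)) natrM mulrACA kz1 py1 mulr1.
Qed.

(** * Annihilators and the exchange argument *)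

Section Annihilator.
Variable R : finComPzRingType.
Implicit Types S T D : {set R}.

Definition ann S : {set R} := [set x | [forall y in S, x * y == 0]].

Lemma annP S x : reflect {in S, forall y, x * y = 0} (x \in ann S).
Proof. by rewrite inE; apply: (iffP forall_inP) => xS y /xS/eqP. Qed.

Lemma ann0 S : 0 \in ann S.
Proof. by apply/annP=> y _; rewrite mul0r. Qed.

Lemma annD S : {in ann S &, forall x y, x + y \in ann S}.
Proof.
move=> x y /annP xS /annP yS; apply/annP=> z Sz.
by rewrite mulrDl xS // yS // addr0.
Qed.

Lemma annS S T : S \subset T -> ann T \subset ann S.
Proof.
by move=> /subsetP sST; apply/subsetP=> x /annP xT; apply/annP=> y /sST/xT.
Qed.

Lemma sub_annann S : S \subset ann (ann S).
Proof.
by apply/subsetP=> x Sx; apply/annP=> y /annP yS; rewrite mulrC yS.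
Qed.

(** Squares are included, unlike in a clique. *)
Definition zero_product S := S \subset ann S.

Lemma zero_product_annann D : zero_product D -> zero_product (ann (ann D)).
Proof. by move=> zD; do 2!apply: annS. Qed.

Lemma zero_productP D : reflect {in D &, forall x y, x * y = 0} (zero_product D).
Proof.
apply: (iffP subsetP) => [zD x y Dx Dy|zD x Dx]; first by move/annP: (zD x Dx) => ->.
by apply/annP=> y; apply: zD.
Qed.

Lemma cliqueP S :
  reflect {in S &, forall x y, x != y -> x * y = 0} (clique S).
Proof.
apply: (iffP forall_inP) => [cS x y Sx Sy ne|cS x Sx].
  by move/forall_inP: (cS x Sx) => /(_ y Sy); rewrite ne /= => /andP[_ /eqP].
by apply/forall_inP=> y Sy; apply/implyP=> ne; rewrite /adjacent /= ne cS ?eqxx.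
Qed.

Lemma clique_leq_omega S : clique S -> (#|S| <= omega R)%N.
Proof. exact: (@leq_bigmax_cond _ _ (fun S : {set R} => #|S|)). Qed.

Lemma card_square_parts S :
  #|S| = (#|square_zero_part S| + #|square_nonzero_part S|)%N.
Proof.
rewrite -(cardsID [set x | x ^+ 2 == 0] S); congr (_ + _)%N; apply: eq_card => x.
  by rewrite !inE.
by rewrite !inE andbC.
Qed.

Lemma zero_product_square_zero_part S :
  clique S -> zero_product (square_zero_part S).
Proof.
move/cliqueP=> cS; apply/zero_productP=> x y.
rewrite !inE => /andP[Sx /eqP x2] /andP[Sy _].
by have [<-|/cS->//] := eqVneq x y; rewrite -expr2.
Qed.

Lemma clique_ann_square_zero_part S :
  clique S -> S \subset ann (square_zero_part S).
Proof.
move/cliqueP=> cS; apply/subsetP=> x Sx; apply/annP=> y.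
rewrite inE => /andP[Sy /eqP y2].
by have [->|/cS->//] := eqVneq x y; rewrite -expr2.
Qed.

Lemma clique_setU D E : zero_product D -> clique E -> E \subset ann D ->
  clique (D :|: E).
Proof.
move=> /zero_productP zD /cliqueP cE /subsetP sE; apply/cliqueP=> x y.
rewrite !inE => /orP[Dx|Ex] /orP[Dy|Ey] ne.
- exact: zD.
- by rewrite mulrC; move/annP: (sE y Ey) => ->.
- by move/annP: (sE x Ex) => ->.
- exact: cE.
Qed.

(** The elements of [C] that kill [D] also kill the double annihilator of [D],
    and together with it they form a clique.  Either this clique is smaller than
    [A], which is the second alternative, or it is a maximum clique and the
    first alternative holds because [A] is optimal. *)
Lemma exchange (A D : {set R}) :
    optimal_maximum_clique A -> zero_product D ->
  let B := square_zero_part A in let C := square_nonzero_part A in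
  (#|ann (ann D)| <= #|B|)%N \/ (#|ann (ann D)| < #|B| + #|C :\: ann D|)%N.
Proof.
move=> [/andP[cA /eqP oA] optA] zD B C; set K := ann (ann D).
have zK : zero_product K by apply: zero_product_annann.
pose A' := K :|: (C :&: ann D).
have cC' : clique (C :&: ann D).
  apply/cliqueP=> x y; rewrite !inE => /andP[/andP[Ax _] _] /andP[/andP[Ay _] _].
  by move/cliqueP: cA; apply.
have cA' : clique A'.
  apply: clique_setU => //; apply: (subset_trans _ (sub_annann _)).
  exact: subsetIr.
have K2 x : x \in K -> x ^+ 2 = 0.
  by move=> Kx; rewrite expr2; move/zero_productP: zK; apply.
have oA' : #|A'| = (#|K| + #|C :&: ann D|)%N.
  rewrite cardsU; have -> : K :&: (C :&: ann D) = set0.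
    apply/setP=> x; rewrite !in_setI [x \in C]inE in_set0; apply/negP.
    by case/andP=> /K2->; rewrite eqxx andbF.
  by rewrite cards0 subn0.
have := clique_leq_omega cA'; rewrite -oA oA' (card_square_parts A) -/B -/C.
rewrite -(cardsID (ann D) C).
rewrite leq_eqVlt => /orP[eqK|ltK]; last by right; lia.
left; have maxA' : maximum_clique A'.
  rewrite /maximum_clique cA' oA' (eqP eqK) -oA (card_square_parts A).
  by rewrite -/B -/C -(cardsID (ann D) C) eqxx.
apply: leq_trans (optA _ maxA'); apply: subset_leq_card; apply/subsetP=> x Kx.
by rewrite inE in_setU Kx K2 ?eqxx.
Qed.

End Annihilator.

(** * Square-zero parts in a local ring *)

Section LocalClique.
Variables (R : finComNzRingType) (A : {set R}).
Hypotheses (localR : local_ring R) (optA : optimal_maximum_clique A).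
Let B := square_zero_part A.
Let C := square_nonzero_part A.
Let trivR := local_ring_trivial_idempotents localR.

Let cliqueA : clique A. Proof. by case: optA => /andP[]. Qed.

Let zeroB : zero_product B. Proof. exact: zero_product_square_zero_part. Qed.

Lemma annann_square_zero_part : ann (ann B) = B.
Proof.
apply/esym/eqP; rewrite eqEcard sub_annann.
have sC : C :\: ann B = set0.
  apply/eqP; rewrite setD_eq0; apply/subsetP=> x; rewrite inE => /andP[Ax _].
  by move/subsetP: (clique_ann_square_zero_part cliqueA); apply.
by case: (exchange optA zeroB) => //; rewrite -/B -/C sC cards0 addn0 => /ltnW.
Qed.

Let card_annann (p : nat) (D : {set R}) :
  prime p -> nilpotent (p%:R : R) -> exists a, #|ann (ann D)| = (p ^ a)%N.
Proof.
move=> p_prime [N pN0]; apply: (@card_ptorsion_subgroup _ _ _ N) => //.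
- exact: ann0.
- exact: annD.
- by move=> x _; rewrite -mulr_natr natrX pN0 mulr0.
Qed.

(** [#|ann (ann D)|] and [#|B|] are powers of [p], and the second alternative of
    [exchange] gives [#|ann (ann D)| < p * #|B|]. *)
Lemma exchange_local (p : nat) (D : {set R}) :
    prime p -> nilpotent (p%:R : R) -> zero_product D ->
    (#|C :\: ann D| <= p.-1 * #|B|)%N ->
  (#|ann (ann D)| <= #|B|)%N.
Proof.
move=> p_prime pnil zD small; case: (exchange optA zD) => //; rewrite -/B -/C.
have [a oD] := card_annann D p_prime pnil; have [b] := card_annann B p_prime pnil.
rewrite annann_square_zero_part oD => oB lt_ab.
have p_gt1 := prime_gt1 p_prime.
rewrite oB leq_exp2l // -ltnS -(ltn_exp2l _ _ p_gt1) expnS -oB.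
apply: (leq_trans lt_ab).
by rewrite -[X in (_ <= X * _)%N](ltn_predK p_gt1) mulSn leq_add2l.
Qed.

(** The exchange for [x |: B]: its double annihilator contains [B] and is not
    larger than [B], hence it is [B]. *)
Lemma square_zero_part_absorb (p : nat) (x : R) :
    prime p -> nilpotent (p%:R : R) -> x ^+ 2 = 0 -> x \in ann B ->
    (#|C :\: ann [set x]| <= p.-1 * #|B|)%N ->
  x \in B.
Proof.
move=> p_prime pnil x2 /annP xB small.
have zD : zero_product (x |: B).
  apply/zero_productP=> y z; rewrite !in_setU1 => /predU1P[->|By] /predU1P[->|Bz].
  - by rewrite -expr2.
  - exact: xB.
  - by rewrite mulrC xB.
  - exact: (zero_productP _ zeroB).
have leB : (#|ann (ann (x |: B))| <= #|B|)%N.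
  apply: (exchange_local p_prime pnil zD); apply: leq_trans small.
  apply: subset_leq_card; apply/subsetP=> c.
  rewrite !in_setD => /andP[nc Cc]; rewrite Cc andbT.
  apply: contra nc => /annP cx; apply/annP=> y; rewrite in_setU1 => /predU1P[->|By].
    by apply: cx; rewrite inE.
  move: Cc; rewrite inE => /andP[Ac _].
  by move/subsetP: (clique_ann_square_zero_part cliqueA) => /(_ c Ac)/annP; apply.
have sD : x |: B \subset ann (ann (x |: B)) by apply: sub_annann.
have /eqP-> : B == ann (ann (x |: B)).
  by rewrite eqEcard leB andbT (subset_trans _ sD) // subsetUr.
by apply: (subsetP sD); rewrite setU11.
Qed.

Lemma square_zero_part_gt0 : (0 < #|B|)%N.
Proof. by apply/card_gt0P; exists 0; rewrite -annann_square_zero_part ann0. Qed.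

Let C_mul c d : c \in C -> d \in C -> c != d -> c * d = 0.
Proof.
rewrite !inE => /andP[Ac _] /andP[Ad _].
by move/cliqueP: cliqueA; apply.
Qed.

Let C_ann c : c \in C -> c \in ann B.
Proof.
rewrite inE => /andP[Ac _].
exact: (subsetP (clique_ann_square_zero_part cliqueA)).
Qed.

Let C_sqr c : c \in C -> c * c != 0.
Proof. by rewrite inE expr2 => /andP[]. Qed.

Let B_mulC b c : b \in B -> c \in C -> b * c = 0.
Proof. by move=> Bb /C_ann/annP; rewrite mulrC; apply. Qed.

(** Otherwise [x = r ^+ k * c] has square zero for some [k > 0] with
    [x * c != 0].  Within [C] only [c] fails to kill [x], so
    [x] is absorbed by [B], and then it must kill [c]. *)
Lemma nilpotent_mul_sqr (r c : R) : nilpotent r -> c \in C -> r * c ^+ 2 = 0.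
Proof.
move=> r_nil Cc; have [p p_prime pnil] := residue_characteristic trivR.
apply/eqP/negPn/negP=> nz.
have exk : exists k, r ^+ k * c ^+ 2 == 0.
  by case: r_nil => k rk0; exists k; rewrite rk0 mul0r.
(* r ^+ k is the last power of r that does not kill c ^+ 2; as k >= 1, we have
   2 k >= k + 1 and so r ^+ (2 k) kills c ^+ 2. *)
have [[|k] /eqP rk0 mink] := ex_minnP exk.
  by move: (C_sqr Cc); rewrite -expr2 -[c ^+ 2]mul1r rk0 eqxx.
have nzk : r ^+ k * c ^+ 2 != 0 by apply/negP=> /mink; rewrite ltnn.
have k_gt0 : (0 < k)%N.
  by case: k rk0 {mink nzk} => //; rewrite expr1 => rc0; rewrite rc0 eqxx in nz.
pose x := r ^+ k * c.
have xc : x * c != 0 by rewrite -mulrA -expr2.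
have Bx : x \in B.
  apply: (square_zero_part_absorb p_prime pnil).
  - rewrite exprMn -exprM muln2 -addnn.
    have -> : (k + k = k.-1 + k.+1)%N by lia.
    by rewrite exprD -mulrA rk0 mulr0.
  - by apply/annP=> b Bb; rewrite /x -mulrA [c * b]mulrC (B_mulC Bb Cc) mulr0.
  apply: (@leq_trans 1); last first.
    by rewrite muln_gt0 square_zero_part_gt0 -subn1 subn_gt0 prime_gt1.
  rewrite -(cards1 c); apply: subset_leq_card; apply/subsetP=> d.
  rewrite in_setD in_set1 => /andP[nd Cd]; apply: contraR nd => ne.
  by apply/annP=> y; rewrite inE => /eqP->; rewrite /x mulrCA (C_mul Cd Cc ne) mulr0.
by rewrite B_mulC ?eqxx in xc.
Qed.

(** An invertible [c] would force all other elements of [C] to be [0]. *)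
Lemma nilpotent_square_nonzero_part c :
  (1 < #|C|)%N -> c \in C -> nilpotent c.
Proof.
move=> C_gt1 Cc; case: (nilpotent_or_invertible c trivR) => // -[y cy1].
have [d] : exists d, d \in C :\ c.
  by apply/card_gt0P; move: C_gt1; rewrite (cardsD1 c C) Cc.
rewrite in_setD1 => /andP[ne_dc Cd]; have := C_sqr Cd.
have d0 : d = 0 by rewrite -[d]mulr1 -cy1 mulrA (C_mul Cd Cc ne_dc) mul0r.
by rewrite d0 mul0r eqxx.
Qed.

Lemma sqr_square_nonzero_part c : (1 < #|C|)%N -> c \in C -> c ^+ 2 \in B.
Proof.
move=> C_gt1 Cc; have [p p_prime pnil] := residue_characteristic trivR.
have c3 : c * c ^+ 2 = 0.
  by apply: nilpotent_mul_sqr => //; apply: nilpotent_square_nonzero_part.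
apply: (square_zero_part_absorb p_prime pnil).
- by rewrite expr2 {1}expr2 -mulrA c3 mulr0.
- by apply/annP=> b Bb; rewrite expr2 -mulrA [c * b]mulrC (B_mulC Bb Cc) mulr0.
rewrite (_ : C :\: _ = set0) ?cards0 //; apply/eqP; rewrite setD_eq0.
apply/subsetP=> d Cd; apply/annP=> y; rewrite inE => /eqP->.
by have [->//|ne] := eqVneq d c; rewrite expr2 mulrA (C_mul Cd Cc ne) mul0r.
Qed.

(** If [C] has at least two elements, the map [c |-> c ^+ 2] sends it to [B]
    with fibres of fewer than [p] elements: the sum of [p] elements of a fibre would be absorbed by [B]. *)
Lemma card_square_nonzero_part p :
    prime p -> nilpotent (p%:R : R) ->
  (#|C| <= p.-1 * #|B|)%N.
Proof.
move=> p_prime pnil; have p_gt1 := prime_gt1 p_prime.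
have p1_gt0 : (0 < p.-1)%N by rewrite -subn1 subn_gt0.
have [C_le1|C_gt1] := leqP #|C| 1%N.
  by apply: (leq_trans C_le1); rewrite muln_gt0 p1_gt0 square_zero_part_gt0.
pose fibre t := [set c in C | c ^+ 2 == t].
have -> : #|C| = (\sum_(t in B) #|fibre t|)%N.
  rewrite -sum1_card (partition_big (fun c => c ^+ 2) (mem B)) => [|c Cc]; last first.
    exact: sqr_square_nonzero_part.
  by apply: eq_bigr => t _; rewrite -sum1_card; apply: eq_bigl => c; rewrite !inE.
rewrite mulnC -sum_nat_const; apply: leq_sum => t Bt.
rewrite -ltnS (ltn_predK p_gt1) ltnNge; apply/negP=> fibre_ge.
have [S sS oS] : exists2 S : {set R}, S \subset fibre t & #|S| = p.
  have /card_gt0P[S] :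
      (0 < #|[set S : {set R} | S \subset fibre t & #|S| == p]|)%N.
    by rewrite cards_draws bin_gt0.
  by rewrite inE => /andP[? /eqP]; exists S.
have SC c : c \in S -> c \in C /\ c * c = t.
  by move/(subsetP sS); rewrite inE -expr2 => /andP[-> /eqP].
pose x := \sum_(c in S) c.
have xS d : d \in S -> x * d = t.
  move=> Sd; have [Cd d2] := SC d Sd.
  rewrite /x mulr_suml (bigD1 d) //= d2 big1 ?addr0 // => c /andP[/SC[Cc _] ne].
  exact: C_mul.
have xC d : d \in C -> d \notin S -> x * d = 0.
  move=> Cd nSd; rewrite /x mulr_suml big1 // => c Sc.
  by apply: C_mul => //; [case: (SC c Sc) | apply: contraNneq nSd => <-].
have [d Sd] : exists d, d \in S by apply/card_gt0P; rewrite oS prime_gt0.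
have [Cd d2] := SC d Sd; have nzt : t != 0 by rewrite -d2 C_sqr.
have B_gt1 : (1 < #|B|)%N.
  apply/card_gt1P; exists 0, t; split=> //; last by rewrite eq_sym.
  by rewrite -annann_square_zero_part ann0.
have Bx : x \in B.
  apply: (square_zero_part_absorb p_prime pnil).
  - rewrite expr2 {2}/x mulr_sumr (eq_bigr (fun=> t)) => [|c /xS//].
    by rewrite sumr_const oS -d2 -mulr_natl -expr2 nilpotent_mul_sqr.
  - apply/annP=> b Bb; rewrite /x mulr_suml big1 // => c /SC[Cc _].
    by rewrite mulrC B_mulC.
  apply: (@leq_trans p); last first.
    (* p <= 2 (p - 1), and #|B| >= 2 because B contains both 0 and t. *)
    apply: (@leq_trans (p.-1 * 2)); first by rewrite muln2 -addnn; lia.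
    by rewrite leq_mul2l B_gt1 orbT.
  rewrite -oS; apply: subset_leq_card; apply/subsetP=> c.
  rewrite in_setD => /andP[nc Cc]; apply: contraR nc => nSc.
  by apply/annP=> y; rewrite inE mulrC => /eqP->; apply: xC.
by case/eqP: nzt; rewrite -(xS d Sd) B_mulC.
Qed.

(** Exchanging for [D] replaces at most all of [C], and [C] is small enough for
    [exchange_local]. *)
Lemma card_zero_product (D : {set R}) : zero_product D -> (#|D| <= #|B|)%N.
Proof.
move=> zD; have [p p_prime pnil] := residue_characteristic trivR.
apply: leq_trans (subset_leq_card (sub_annann D)) _.
apply: (exchange_local p_prime pnil zD).
apply: leq_trans (card_square_nonzero_part p_prime pnil).
exact/subset_leq_card/subsetDl.
Qed.

End LocalClique.

(** * Cliques in a product of rings *)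

Lemma leq_omega_injective (R S : finComPzRingType) (f : R -> S) :
    injective f -> (forall x y, x * y = 0 -> f x * f y = 0) ->
  (omega R <= omega S)%N.
Proof.
move=> inj_f f0; apply/bigmax_leqP=> A /cliqueP cA.
rewrite -(card_imset _ inj_f); apply/clique_leq_omega/cliqueP.
move=> _ _ /imsetP[x Ax ->] /imsetP[y Ay ->] ne.
by apply: f0; apply: cA => //; apply: contraNneq ne => ->.
Qed.

Lemma omega_isomorphic (R S : finComPzRingType) :
  ring_isomorphic R S -> omega R = omega S.
Proof.
case=> f [g fK gK]; apply/eqP; rewrite eqn_leq; apply/andP; split.
  by apply: (leq_omega_injective (can_inj fK)) => x y; rewrite -rmorphM => ->; rewrite rmorph0.
apply: (leq_omega_injective (can_inj gK)) => x y xy0.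
by apply: (can_inj fK); rewrite rmorphM !gK xy0 rmorph0.
Qed.

(** Raising one factor by [d] raises the product by at least [d], the other
    factors being positive. *)
Lemma prod_gap_leq (I : Type) (r : seq I) (b b' : I -> nat) :
    (forall i, 0 < b' i <= b i)%N ->
  (\prod_(i <- r) b' i + \sum_(i <- r) (b i - b' i) <= \prod_(i <- r) b i)%N.
Proof.
move=> le_b; elim: r => [|i r IH]; first by rewrite !big_nil.
have gt0 : (0 < \prod_(j <- r) b' j)%N.
  by apply: prodn_gt0 => j; case/andP: (le_b j).
rewrite !big_cons; case/andP: (le_b i) => b'_gt0 leb.
have := leq_mul (leqnn (b i)) IH.
move: (\prod_(j <- r) b' j)%N (\sum_(j <- r) _)%N (\prod_(j <- r) b j)%N gt0.
move=> P' S P gt0; rewrite mulnDr; apply: leq_trans.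
rewrite addnA leq_add //; last by rewrite leq_pmull //; apply: leq_trans leb.
by rewrite -{2}(subnKC leb) mulnDl leq_add2l leq_pmulr.
Qed.

Section ProductClique.
Variables (n : nat) (R_ : 'I_n -> finComNzRingType).
Local Notation P := (prod_ring R_).

Lemma prod_mulE (x y : P) i : (x * y) i = x i * y i.
Proof. by rewrite ffunE. Qed.

Lemma prod_zeroE i : (0 : P) i = 0.
Proof. by rewrite ffunE. Qed.

Lemma prod_eq0P (x : P) : reflect (forall i, x i = 0) (x == 0).
Proof.
apply: (iffP eqP) => [-> i|x0]; first exact: prod_zeroE.
by apply/ffunP=> i; rewrite x0 prod_zeroE.
Qed.

Definition coord_embed i (c : R_ i) : P := 
  [ffun j => @dfwith 'I_n R_ (fun=> 0) i c j].

Lemma coord_embed_in i (c : R_ i) : coord_embed c i = c.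
Proof. by rewrite ffunE dfwith_in. Qed.

Lemma coord_embed_out i j (c : R_ i) : i != j -> coord_embed c j = 0.
Proof. by move=> ne; rewrite ffunE dfwith_out. Qed.

Lemma coord_embed_mul i (c : R_ i) (x : P) :
  c * x i = 0 -> coord_embed c * x = 0.
Proof.
move=> cx0; apply/eqP/prod_eq0P=> j; rewrite prod_mulE.
have [eq_ij|ne] := eqVneq i j; last by rewrite coord_embed_out ?mul0r.
by case: j / eq_ij; rewrite coord_embed_in.
Qed.

Section LowerBound.
Variable A : forall i, {set R_ i}.
Hypothesis cliqueA : forall i, clique (A i).
Let B i := square_zero_part (A i).
Let C i := square_nonzero_part (A i).

Let embC i : {set P} := [set coord_embed c | c in C i].

(** The clique consists of [\prod B_i] and the copies of the [C_i] on the
    coordinate axes.  These parts are disjoint: the [i]-th coordinate of an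
    element of the former has square zero. *)
Lemma omega_prod_geq : (\prod_(i < n) #|B i| + \sum_(i < n) #|C i| <= omega P)%N.
Proof.
pose D : {set P} := setXn B; pose E := \bigcup_i embC i.
have DP (x : P) : x \in D -> forall i, x i \in B i by move/setXnP.
have EP (x : P) : x \in E -> exists i, exists2 c, c \in C i & x = coord_embed c.
  by case/bigcupP=> i _ /imsetP[c Cc ->]; exists i, c.
have sqrC i c : c \in C i -> c * c != 0 by rewrite inE expr2 => /andP[].
have zD : zero_product D.
  apply/zero_productP=> x y /DP Dx /DP Dy; apply/eqP/prod_eq0P=> i.
  rewrite prod_mulE.
  exact: (zero_productP _ (zero_product_square_zero_part (cliqueA i)) _ _ (Dx i) (Dy i)).
have cE : clique E.
  apply/cliqueP=> x y /EP[i [c Cc ->]] /EP[j [d Cd ->]] ne.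
  apply: coord_embed_mul; have [eq_ji|ne_ji] := eqVneq j i; last first.
    by rewrite coord_embed_out ?mulr0.
  case: i / eq_ji c Cc ne => c Cc ne; rewrite coord_embed_in.
  have ne_cd : c != d by apply: contraNneq ne => ->.
  move: Cc Cd; rewrite !inE => /andP[Ac _] /andP[Ad _].
  exact: (cliqueP _ (cliqueA j) _ _ Ac Ad).
have sE : E \subset ann D.
  apply/subsetP=> x /EP[i [c Cc ->]]; apply/annP=> y /DP Dy.
  apply: coord_embed_mul; move: Cc; rewrite inE => /andP[Ac _].
  exact: (annP _ _ (subsetP (clique_ann_square_zero_part (cliqueA i)) c Ac) _ (Dy i)).
have embC_sqr i x : x \in embC i -> exists2 c : R_ i, x = coord_embed c & c * c != 0.
  by case/imsetP=> c /sqrC c2 ->; exists c.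
apply: leq_trans (clique_leq_omega (clique_setU zD cE sE)).
rewrite cardsU (_ : D :&: E = set0) ?cards0 ?subn0; last first.
  apply/setP=> x; rewrite in_setI in_set0; apply/negP=> /andP[Dx].
  case/bigcupP=> i _ /embC_sqr[c def_x]; have := DP x Dx i.
  by rewrite def_x coord_embed_in inE expr2 => /andP[_ ->].
rewrite cardsXn leq_add2l -sum1_card /E partition_disjoint_bigcup /=.
  apply: leq_sum => i _; rewrite sum1_card card_imset // => c d.
  by move/(congr1 (fun x : P => x i)); rewrite !coord_embed_in.
move=> i j ne_ij; rewrite -setI_eq0; apply/eqP/setP=> x; rewrite in_setI in_set0.
apply/negP=> /andP[/embC_sqr[c -> c2] /embC_sqr[d]].
move/(congr1 (fun x : P => x i)); rewrite coord_embed_in coord_embed_out 1?eq_sym //.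
by move=> c0; rewrite c0 mul0r eqxx in c2.
Qed.

End LowerBound.

Section UpperBound.
Hypothesis localR : forall i, local_ring (R_ i).
Variable A : forall i, {set R_ i}.
Hypothesis optA : forall i, optimal_maximum_clique (A i).
Let B i := square_zero_part (A i).
Let C i := square_nonzero_part (A i).

(** With [D_i] and [E_i] as in the proof idea above, [card_zero_product] gives
    [#|D_i| <= b_i], and what [E_i] may gain over [c_i] is at most
    [b_i - #|D_i|]; by [prod_gap_leq] the product loses at least the sum of these
    gaps.  Adding [0] to [D_i] keeps all factors positive. *)
Lemma omega_prod_leq : (omega P <= \prod_(i < n) #|B i| + \sum_(i < n) #|C i|)%N.
Proof.
apply/bigmax_leqP=> S cS.
have mulS := cliqueP _ cS.
pose D i : {set R_ i} := 0 |: [set x i | x : P in square_zero_part S].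
pose E i : {set R_ i} := [set x i | x : P in [set y in S | y i * y i != 0]].
have zS := zero_productP _ (zero_product_square_zero_part cS).
have zD i : zero_product (D i).
  apply/zero_productP=> u v; rewrite !in_setU1.
  case/predU1P=> [->|/imsetP[x Sx ->]]; first by rewrite mul0r.
  case/predU1P=> [->|/imsetP[y Sy ->]]; first by rewrite mulr0.
  by rewrite -prod_mulE zS // prod_zeroE.
have cE i : clique (E i).
  apply/cliqueP=> u v /imsetP[x Sx ->] /imsetP[y Sy ->] ne.
  move: Sx Sy; rewrite !inE => /andP[Sx _] /andP[Sy _].
  by rewrite -prod_mulE mulS ?prod_zeroE //; apply: contraNneq ne => ->.
have sE i : E i \subset ann (D i).
  apply/subsetP=> u /imsetP[x]; rewrite inE => /andP[Sx _] ->; apply/annP=> v.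
  rewrite in_setU1 => /predU1P[->|/imsetP[y Sy ->]]; first by rewrite mulr0.
  have /annP := subsetP (clique_ann_square_zero_part cS) _ Sx.
  by rewrite -prod_mulE => ->; rewrite ?prod_zeroE.
have DE i : D i :&: E i = set0.
  apply/setP=> u; rewrite in_setI in_set0; apply/negP=> /andP[Du /imsetP[x]].
  rewrite inE => /andP[_ xi] def_u; case/negP: xi; rewrite -def_u.
  by rewrite (zero_productP _ (zD i)).
have leD i : (0 < #|D i| <= #|B i|)%N.
  rewrite (card_zero_product (localR i) (optA i) (zD i)) andbT.
  by apply/card_gt0P; exists 0; rewrite setU11.
have leDE i : (#|D i| + #|E i| <= #|B i| + #|C i|)%N.
  have := clique_leq_omega (clique_setU (zD i) (cE i) (sE i)).
  rewrite cardsU DE cards0 subn0; case: (optA i) => /andP[_ /eqP<-] _.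
  by rewrite (card_square_parts (A i)).
have leS0 : (#|square_zero_part S| <= \prod_(i < n) #|D i|)%N.
  rewrite -cardsXn; apply: subset_leq_card; apply/subsetP=> x Sx; apply/setXnP=> i.
  by rewrite in_setU1; apply/orP; right; apply: imset_f.
(* An element of nonzero square has a coordinate of nonzero square, and at such
   a coordinate it differs from every other element of the clique. *)
have leS1 : (#|square_nonzero_part S| <= \sum_(i < n) #|E i|)%N.
  apply: (@leq_trans #|\bigcup_i [set y in S | y i * y i != 0]|).
    apply: subset_leq_card; apply/subsetP=> x; rewrite inE expr2 => /andP[Sx].
    move/eqP=> x2; case: (pickP (fun i => x i * x i != 0)) => [i xi|xi0].
      by apply/bigcupP; exists i; rewrite // inE Sx.
    case: x2; apply/eqP/prod_eq0P=> i; rewrite prod_mulE; apply/eqP.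
    exact: (negbFE (xi0 i)).
  elim/big_ind2: _ => [|m1 X1 m2 X2 h1 h2|i _]; first by rewrite cards0.
    by apply: leq_trans (leq_add h1 h2); rewrite cardsU leq_subr.
  rewrite card_in_imset // => x y; rewrite !inE => /andP[Sx xi] /andP[Sy _] eq_i.
  apply/eqP; apply: contraR xi => ne; rewrite {2}eq_i -prod_mulE mulS //.
  by rewrite prod_zeroE.
rewrite (card_square_parts S); apply: leq_trans (leq_add leS0 leS1) _.
apply: leq_trans (leq_add (prod_gap_leq (index_enum 'I_n) leD) (leqnn _)).
rewrite -addnA leq_add2l -big_split; apply: leq_sum => i _.
have := leDE i; case/andP: (leD i) => _ /=.
by move: #|D i| #|B i| #|C i| #|E i| => d b c e; lia.
Qed.

End UpperBound.
End ProductClique.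

(** * Decomposition into local rings *)

Definition primitive_idempotent (R : finComPzRingType) (e : R) :=
  [&& e * e == e, e != 0 &
      [forall f : R, (f * f == f) ==> (e * f == 0) || (e * f == e)]].

Lemma primitive_idempotentP (R : finComPzRingType) (e : R) :
  reflect [/\ e * e = e, e != 0 &
             forall f, f * f = f -> e * f = 0 \/ e * f = e]
          (primitive_idempotent e).
Proof.
apply: (iffP and3P) => [[/eqP ee nz /forallP min]|[ee nz min]]; split=> //.
- move=> f ff; have /implyP/(_ (introT eqP ff))/orP[] := min f.
    by move/eqP; left.
  by move/eqP; right.
- exact/eqP.
- apply/forallP=> f; apply/implyP=> /eqP/min[->|->]; first by rewrite eqxx.
  by rewrite eqxx orbT.
Qed.

Section Corner.
Variables (R : finComPzRingType) (e : R).
Hypothesis prim_e : primitive_idempotent e.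

(** The ring [e R], with unit [e].  The proof that [e] is primitive is a
    parameter because [e R] is a nonzero ring with unit [e] only for a nonzero
    idempotent [e]. *)
Definition corner of primitive_idempotent e : Type := {x : R | e * x == x}.
Local Notation eR := (corner prim_e).

HB.instance Definition _ := Finite.copy eR {x : R | e * x == x}.

Fact corner_proj_subproof (x : R) : e * (e * x) == e * x.
Proof. by case/primitive_idempotentP: prim_e => ee _ _; rewrite mulrA ee. Qed.

Definition corner_proj (x : R) : eR := exist _ (e * x) (corner_proj_subproof x).
Definition corner_val (x : eR) : R := sval x.

Lemma corner_val_inj : injective corner_val.
Proof. exact: val_inj. Qed.

Lemma corner_projK (x : R) : corner_val (corner_proj x) = e * x.
Proof. by []. Qed.

Lemma corner_valK (x : eR) : e * corner_val x = corner_val x.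
Proof. exact/eqP/(svalP x). Qed.

Definition corner_add (x y : eR) := corner_proj (corner_val x + corner_val y).
Definition corner_opp (x : eR) := corner_proj (- corner_val x).
Definition corner_mul (x y : eR) := corner_proj (corner_val x * corner_val y).

Lemma corner_addE x y :
  corner_val (corner_add x y) = corner_val x + corner_val y.
Proof. by rewrite corner_projK mulrDr !corner_valK. Qed.
Lemma corner_oppE x : corner_val (corner_opp x) = - corner_val x.
Proof. by rewrite corner_projK mulrN corner_valK. Qed.
Lemma corner_mulE x y :
  corner_val (corner_mul x y) = corner_val x * corner_val y.
Proof. by rewrite corner_projK mulrA corner_valK. Qed.
Lemma corner_zeroE : corner_val (corner_proj 0) = 0.
Proof. by rewrite corner_projK mulr0. Qed.
Lemma corner_oneE : corner_val (corner_proj 1) = e.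
Proof. by rewrite corner_projK mulr1. Qed.

Fact corner_addA : associative corner_add.
Proof. by move=> x y z; apply: corner_val_inj; rewrite !corner_addE addrA. Qed.
Fact corner_addC : commutative corner_add.
Proof. by move=> x y; apply: corner_val_inj; rewrite !corner_addE addrC. Qed.
Fact corner_add0 : left_id (corner_proj 0) corner_add.
Proof.
by move=> x; apply: corner_val_inj; rewrite corner_addE corner_zeroE add0r.
Qed.
Fact corner_addN : left_inverse (corner_proj 0) corner_opp corner_add.
Proof.
move=> x; apply: corner_val_inj.
by rewrite corner_addE corner_oppE corner_zeroE addNr.
Qed.

HB.instance Definition _ :=
  GRing.isZmodule.Build eR corner_addA corner_addC corner_add0 corner_addN.

Fact corner_mulA : associative corner_mul.
Proof. by move=> x y z; apply: corner_val_inj; rewrite !corner_mulE mulrA. Qed.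
Fact corner_mulC : commutative corner_mul.
Proof. by move=> x y; apply: corner_val_inj; rewrite !corner_mulE mulrC. Qed.
Fact corner_mul1 : left_id (corner_proj 1) corner_mul.
Proof.
move=> x; apply: corner_val_inj.
by rewrite corner_mulE corner_oneE corner_valK.
Qed.
Fact corner_mulD : left_distributive corner_mul +%R.
Proof.
move=> x y z; apply: corner_val_inj.
by rewrite corner_mulE !corner_addE !corner_mulE mulrDl.
Qed.
Fact corner_oner_neq0 : corner_proj 1 != 0.
Proof.
case/primitive_idempotentP: prim_e => _ nz _; apply: contra nz.
by move/eqP/(congr1 corner_val); rewrite corner_oneE corner_zeroE => ->.
Qed.

HB.instance Definition _ :=
  GRing.Zmodule_isComNzRing.Build eR
    corner_mulA corner_mulC corner_mul1 corner_mulD corner_oner_neq0.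

(** An idempotent [f] of [e R] is an idempotent of [R] with [e * f = f], so
    primitivity makes it [0] or [e]. *)
Lemma corner_local : local_ring eR.
Proof.
apply: trivial_idempotents_local_ring => f ff.
have [_ _ min_e] := primitive_idempotentP _ prim_e.
have := min_e (corner_val f); rewrite corner_valK -{1}corner_mulE.
case; first by congr corner_val; apply: ff.
  by rewrite -corner_zeroE => /corner_val_inj; left.
by rewrite -corner_oneE => /corner_val_inj; right.
Qed.

End Corner.

Section Decomposition.
Variable R : finComPzRingType.
Let prims : {set R} := [set e | primitive_idempotent e].

Lemma primitive_idempotent_orthogonal (e f : R) :
  primitive_idempotent e -> primitive_idempotent f -> e != f -> e * f = 0.
Proof.
case/primitive_idempotentP=> ee _ min_e; case/primitive_idempotentP=> ff _ min_f.
case: (min_e f ff) => // ef_e; case: (min_f e ee); rewrite mulrC // => ef_f.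
by rewrite -ef_e ef_f eqxx.
Qed.

(** Take [e] with the smallest ideal [e R] among the nonzero idempotents below
    [g].  For an idempotent [f] with [e * f != 0], the ideal [e f R] is contained
    in [e R], hence equal to it, and so [e] is a multiple of [e * f]. *)
Lemma exists_primitive_idempotent (g : R) :
  g * g = g -> g != 0 -> exists2 e, primitive_idempotent e & e * g = e.
Proof.
move=> gg nz_g.
pose below (e : R) := [&& e * e == e, e != 0 & e * g == e].
have below_g : below g by rewrite /below gg nz_g eqxx.
have [e /and3P[/eqP ee nz_e /eqP eg] min_e] :=
  arg_minnP (fun e => #|[set e * x | x : R]|) below_g.
exists e => //; apply/primitive_idempotentP; split=> // f ff.
have [ef0|nz_ef] := eqVneq (e * f) 0; [by left | right].
have below_ef : below (e * f).
  by rewrite /below nz_ef mulrACA ee ff mulrAC eg eqxx.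
have sub_ef : [set e * f * x | x : R] \subset [set e * x | x : R].
  apply/subsetP=> _ /imsetP[x _ ->]; rewrite -mulrA; exact: imset_f.
have : e \in [set e * f * x | x : R].
  have /eqP-> : [set e * f * x | x : R] == [set e * x | x : R].
    by rewrite eqEcard sub_ef min_e.
  by apply/imsetP; exists e.
case/imsetP=> x _ def_e.
by rewrite {1}def_e mulrAC -(mulrA e) ff -def_e.
Qed.

(** The sum [s] is idempotent.  If [1 - s] were nonzero, there would be a
    primitive idempotent below it, which is killed by [s] and yet is one of the
    summands of [s]. *)
Lemma sum_primitive_idempotents : \sum_(e in prims) e = 1.
Proof.
set s := \sum_(e in prims) e.
have es e : e \in prims -> e * s = e.
  move=> e_prim; rewrite /s mulr_sumr (bigD1 e) //= big1 => [|f /andP[f_prim ne]].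
    by move: e_prim; rewrite inE addr0 => /primitive_idempotentP[].
  move: e_prim f_prim; rewrite !inE eq_sym in ne *.
  by move=> e_prim f_prim; apply: primitive_idempotent_orthogonal.
have ss : s * s = s by rewrite {1}/s mulr_suml; apply: eq_bigr.
apply/esym/subr0_eq/eqP/negPn/negP=> nz.
have [|e e_prim] := @exists_primitive_idempotent (1 - s) _ nz.
  by rewrite mulrBl mul1r mulrBr mulr1 ss subrr subr0.
rewrite mulrBr mulr1 es ?inE // subrr => e0.
by case/primitive_idempotentP: e_prim; rewrite -e0 eqxx.
Qed.

Let prim_enum (i : 'I_#|prims|) : primitive_idempotent (enum_val i).
Proof. by have := enum_valP i; rewrite inE. Qed.

Definition corner_family (i : 'I_#|prims|) : finComNzRingType :=
  corner (prim_enum i).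

Definition to_corners (x : R) : prod_ring corner_family :=
  [ffun i => corner_proj (prim_enum i) x].

Fact to_corners_zmod_morphism : zmod_morphism to_corners.
Proof.
move=> x y; apply/ffunP=> i; rewrite !ffunE; apply: corner_val_inj.
by rewrite corner_addE corner_oppE !corner_projK mulrBr.
Qed.

Fact to_corners_monoid_morphism : monoid_morphism to_corners.
Proof.
split=> [|x y]; apply/ffunP=> i; rewrite !ffunE //; apply: corner_val_inj.
rewrite corner_mulE !corner_projK mulrACA.
by case/primitive_idempotentP: (prim_enum i) => ->.
Qed.

HB.instance Definition _ :=
  GRing.isZmodMorphism.Build R (prod_ring corner_family) to_corners
    to_corners_zmod_morphism.
HB.instance Definition _ :=
  GRing.isMonoidMorphism.Build R (prod_ring corner_family) to_corners
    to_corners_monoid_morphism.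

(** By orthogonality the inverse sums the components in [R]. *)
Lemma to_corners_bijective : bijective to_corners.
Proof.
exists (fun y : prod_ring corner_family => \sum_i corner_val (y i)) => [x|y].
  under eq_bigr do rewrite ffunE corner_projK.
  by rewrite -mulr_suml -(big_enum_val id) sum_primitive_idempotents mul1r.
apply/ffunP=> i; rewrite ffunE; apply: corner_val_inj.
rewrite corner_projK mulr_sumr (bigD1 i) //= corner_valK big1 ?addr0 // => j ne.
rewrite -corner_valK mulrA.
rewrite (primitive_idempotent_orthogonal (prim_enum i) (prim_enum j)) ?mul0r //.
by rewrite (inj_eq enum_val_inj) eq_sym.
Qed.

Lemma local_decomposition :
  exists (n : nat) (R_ : 'I_n -> finComNzRingType),
    (forall i, local_ring (R_ i)) /\ ring_isomorphic R (prod_ring R_).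
Proof.
exists #|prims|, corner_family; split=> [i|]; first exact: corner_local.
by exists to_corners; apply: to_corners_bijective.
Qed.

End Decomposition.

(** * The clique number of a finite ring *)

Local Close Scope ring_scope.

Theorem corollary2p2 (R : finComPzRingType) :
  (exists (n : nat) (R_ : 'I_n -> finComNzRingType),
     (forall i, local_ring (R_ i)) /\ ring_isomorphic R (prod_ring R_)) /\
  (forall (n : nat) (R_ : 'I_n -> finComNzRingType),
     (forall i, local_ring (R_ i)) -> ring_isomorphic R (prod_ring R_) ->
   forall A : (forall i, {set R_ i}),
     (forall i, optimal_maximum_clique (A i)) ->
     let B i := square_zero_part (A i) in
     let C i := square_nonzero_part (A i) in
     omega R = \prod_(i < n) (omega (R_ i) - #|C i|)
               + \sum_(i < n) (omega (R_ i) - #|B i|)).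
Proof.
split=> [|n R_ localR isoR A optA B C]; first exact: local_decomposition.
have cliqueA i : clique (A i) by case: (optA i) => /andP[].
have omegaE i : omega (R_ i) = (#|B i| + #|C i|)%N.
  by case: (optA i) => /andP[_ /eqP <-] _; apply: card_square_parts.
under eq_bigr do rewrite omegaE addnK.
under [X in (_ + X)%N]eq_bigr do rewrite omegaE addKn.
rewrite (omega_isomorphic isoR); apply/eqP.
by rewrite eqn_leq omega_prod_leq ?omega_prod_geq.
Qed.
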